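(* Let $t(n,k)$ be the number of paths in $\mathcal{M}_1$ of length $n$ whose end-point has height $k$, and let $\mathit{Total}(z,u)=\sum_{n,k\ge 0}t(n,k)z^nu^k$ be the bivariate generating function of the paths in $\mathcal{M}_1$ with respect to the length and the height of the end-point. Then $$\mathit{Total}(z,u)=\frac{1+rs-z}{r-u},$$ and for every $k\ge 0$ $$[u^k]\,\mathit{Total}(z,u)=\frac{1+rs-z}{r^{k+1}}.$$ Moreover, for $n\geq 2$, $k\geq 1$, $$t(n,k)=t(n,k-1)+t(n-1,k)-t(n-1,k-2)-t(n-2,k)-t(n-2,k-1),$$ and, setting $t_n:=t(n,0)$, for $n\ge 2$, $$t_n=t_{n-1}+t_{n-2}+\sum_{k=0}^{n-3}t_{k}t_{n-k-3}+\sum_{k=2}^{n-1}\left(t_k-t_{k-1}\right)t_{n-k-1}.$$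
   Context: Let $U=(1,1)$, $H=(1,0)$ and $D_k=(1,-k)$ for $k\ge 1$ (down steps). $\mathcal{M}_1$ is the set of lattice paths in $\mathbb{N}^2$ (with $\mathbb{N}=\{0,1,2,\dots\}$, so paths never go below the $x$-axis) starting at the origin, made of steps $U$, $H$ and $D_k$ ($k\ge1$), in which two down steps are never consecutive. The empty path belongs to $\mathcal{M}_1$. The length of a path is its number of steps; the height of a point is its ordinate. By convention $t(n,k)=0$ when $k<0$, and empty sums are $0$. The Laurent series $r,s$ in $z$ are $$r=\frac{1-z^{2}+\sqrt{z^{4}-4 z^{3}+2 z^{2}-4 z +1}}{2 z},\qquad s=\frac{1-z^{2}-\sqrt{z^{4}-4 z^{3}+2 z^{2}-4 z +1}}{2 z},$$ where the square root is the power series with constant term $1$. Fractions such as $1/(r-u)$ are expanded as $\sum_{k\ge0}u^k/r^{k+1}$. *)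

(* Defs.v *)
From HB Require Import structures.
From mathcomp Require Import all_boot all_order all_algebra.
From mathcomp Require Import finmap ring zify.
From mathcomp Require Import boolp classical_sets cardinality.

Set Implicit Arguments.
Unset Strict Implicit.
Unset Printing Implicit Defensive.

Import Order.TTheory GRing.Theory Num.Theory.
Local Open Scope ring_scope.

Notation "x %:F" := (tofrac x) : ring_scope.

(** * Formal power series in one variable *)

(* A record, not an alias of [nat -> R], so that the Cauchy product does not
   clash with the pointwise ring structure on functions. *)
Record powser (R : Type) := PowSer { coefs : nat -> R }.

Notation "{ 'powser' R }" := (powser R) (format "{ 'powser'  R }") : type_scope.
Notation "\powser_ ( n ) E" := (PowSer (fun n : nat => E))
  (at level 36, E at level 36, n at level 50,
   format "\powser_ ( n )  E") : ring_scope.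
Notation "[ 'coef' n ] f" := (coefs f n)
  (at level 10, n at level 50, f at level 9, format "[ 'coef'  n ]  f")
  : ring_scope.

Lemma powserP (R : Type) (f g : {powser R}) :
  (forall n, [coef n] f = [coef n] g) -> f = g.
Proof. by case: f g => f [g] /= /funext ->. Qed.

HB.instance Definition _ (R : Type) := gen_eqMixin {powser R}.
HB.instance Definition _ (R : Type) := gen_choiceMixin {powser R}.

Section Ring.
Variable R : comNzRingType.
Implicit Types f g h : {powser R}.

Definition ps_add f g : {powser R} := \powser_(n) ([coef n] f + [coef n] g).
Definition ps_opp f : {powser R} := \powser_(n) (- [coef n] f).
Definition ps_mul f g : {powser R} :=
  \powser_(n) (\sum_(i < n.+1) [coef i] f * [coef (n - i)] g).
Definition psC (c : R) : {powser R} := \powser_(n) (if n == 0%N then c else 0).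
Definition psX : {powser R} := \powser_(n) (if n == 1%N then 1 else 0).

Let addA : associative ps_add.
Proof. by move=> f g h; apply: powserP => n /=; rewrite addrA. Qed.
Let addC : commutative ps_add.
Proof. by move=> f g; apply: powserP => n /=; rewrite addrC. Qed.
Let add0 : left_id (psC 0) ps_add.
Proof. by move=> f; apply: powserP => n /=; rewrite if_same add0r. Qed.
Let addN : left_inverse (psC 0) ps_opp ps_add.
Proof. by move=> f; apply: powserP => n /=; rewrite if_same addNr. Qed.

HB.instance Definition _ :=
  GRing.isZmodule.Build {powser R} addA addC add0 addN.

(* The ring axioms are transferred from {poly R} by truncation. *)
Let trunc n f : {poly R} := \poly_(i < n) [coef i] f.

Let coef_mul_trunc n m f g : (n < m)%N ->
  [coef n] (ps_mul f g) = (trunc m f * trunc m g)`_n.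
Proof.
move=> nm; rewrite coefM /=; apply: eq_bigr => i _.
rewrite !coef_poly (leq_ltn_trans _ nm) ?(leq_ltn_trans _ nm) ?leq_subr //.
by rewrite -ltnS.
Qed.

Let mulC : commutative ps_mul.
Proof.
by move=> f g; apply: powserP => n; rewrite !(@coef_mul_trunc n n.+1) // mulrC.
Qed.

Let coef_trunc_mul n m f g (p : {poly R}) : (n < m)%N ->
  (trunc m (ps_mul f g) * p)`_n = (trunc m f * trunc m g * p)`_n.
Proof.
move=> nm; rewrite !coefM; apply: eq_bigr => i _.
have im : (i < m)%N by apply: leq_ltn_trans nm; rewrite -ltnS.
by rewrite coef_poly im (@coef_mul_trunc i m).
Qed.

Let mulA : associative ps_mul.
Proof.
move=> f g h; apply: powserP => n; rewrite [in LHS]mulC.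
rewrite !(@coef_mul_trunc n n.+1) // !coef_trunc_mul //.
by rewrite mulrC mulrA.
Qed.
Let mul1 : left_id (psC 1) ps_mul.
Proof.
move=> f; apply: powserP => n /=; rewrite big_ord_recl /= mul1r subn0.
by rewrite big1 ?addr0 // => i _; rewrite /= mul0r.
Qed.
Let mulD : left_distributive ps_mul ps_add.
Proof.
move=> f g h; apply: powserP => n /=; rewrite -big_split /=.
by apply: eq_bigr => i _; rewrite mulrDl.
Qed.
Let one_neq0 : psC 1 != 0.
Proof.
by apply/eqP => /(congr1 (fun f => [coef 0] f))/eqP /=; rewrite oner_eq0.
Qed.

HB.instance Definition _ :=
  GRing.Zmodule_isComNzRing.Build {powser R} mulA mulC mul1 mulD one_neq0.

(* Units are the elements possessing an inverse; the inverse of a non-unit is,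
   as everywhere in the library, the element itself. *)
Definition ps_unit f : bool := `[< exists g, g * f = 1 >].
Definition ps_inv f : {powser R} := xget f [set g | g * f = 1]%classic.

Let mulV : {in ps_unit, left_inverse 1 ps_inv *%R}.
Proof.
by move=> f /asboolP[g gf]; rewrite /ps_inv; case: xgetP => [h _ //|/(_ g)].
Qed.
Let unitP f g : g * f = 1 -> ps_unit f.
Proof. by move=> gf; apply/asboolP; exists g. Qed.
Let inv_out : {in [predC ps_unit], ps_inv =1 id}.
Proof.
move=> f /asboolPn nf; rewrite /ps_inv; case: xgetP => // g _ gf.
by case: nf; exists g.
Qed.

HB.instance Definition _ :=
  GRing.ComNzRing_hasMulInverse.Build {powser R} mulV unitP inv_out.

Lemma coefs0 n : [coef n] (0 : {powser R}) = 0.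
Proof. exact: if_same. Qed.
Lemma coefs1 n : [coef n] (1 : {powser R}) = if n == 0%N then 1 else 0.
Proof. by []. Qed.
Lemma coefsD f g n : [coef n] (f + g) = [coef n] f + [coef n] g.
Proof. by []. Qed.
Lemma coefsN f n : [coef n] (- f) = - [coef n] f.
Proof. by []. Qed.
Lemma coefsM f g n :
  [coef n] (f * g) = \sum_(i < n.+1) [coef i] f * [coef (n - i)] g.
Proof. by []. Qed.

Lemma coefsXM f n :
  [coef n] (psX * f) = if n is m.+1 then [coef m] f else 0.
Proof.
rewrite coefsM; case: n => [|n]; first by rewrite big_ord1 mul0r.
rewrite big_ord_recl mul0r add0r big_ord_recl /= mul1r subSS subn0.
by rewrite big1 ?addr0 // => i _; rewrite mul0r.
Qed.

Lemma coefsXnM k f n :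
  [coef n] (psX ^+ k * f) = if (n < k)%N then 0 else [coef (n - k)] f.
Proof.
elim: k n => [|k IH] n; first by rewrite mul1r subn0.
by rewrite exprS -mulrA coefsXM; case: n => [|n] //; rewrite IH ltnS subSS.
Qed.

Lemma coefsCM c f n : [coef n] (psC c * f) = c * [coef n] f.
Proof.
rewrite coefsM big_ord_recl subn0 big1 ?addr0 // => i _.
by rewrite mul0r.
Qed.

Lemma powser_rec (F : seq R -> R) :
  exists f, forall n, [coef n] f = F (mkseq (coefs f) n).
Proof.
pose s := fix s n := if n is m.+1 then rcons (s m) (F (s m)) else [::].
have ss n : size (s n) = n by elim: n => //= n IH; rewrite size_rcons IH.
pose f : {powser R} := \powser_(n) (F (s n)).
suff Es n : s n = mkseq (coefs f) n by exists f => n; rewrite -Es.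
elim: n => // n IH.
by rewrite /mkseq -[in RHS]addn1 iotaD map_cat -/(mkseq _ n) -IH cats1.
Qed.

Lemma powser_factor f : f != 0 ->
  exists v g, f = psX ^+ v * g /\ [coef 0] g != 0.
Proof.
move=> f0; have /existsNP[n /eqP fn] : ~ forall n, [coef n] f = 0.
  by move=> F; case/eqP: f0; apply: powserP => n; rewrite F coefs0.
have [v fv vmin] := ex_minnP (ex_intro (fun n => [coef n] f != 0) n fn).
exists v, (\powser_(i) [coef (i + v)] f); split=> //.
apply: powserP => i; rewrite coefsXnM; case: ltnP => [iv|vi] /=.
  by apply/eqP; apply: contraTT iv; rewrite -leqNgt => /vmin.
by rewrite subnK.
Qed.

End Ring.

Lemma powser_unit (R : comUnitRingType) (f : {powser R}) :
[coef 0] f \is a GRing.unit -> f \is a GRing.unit.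
Proof.
move=> f0.
have [g Hg] := powser_rec (fun s => ([coef 0] f)^-1 *
  ((if size s == 0%N then 1 else 0)
    - \sum_(i < size s) s`_i * [coef (size s - i)] f)).
apply/asboolP; exists g; apply: powserP => n.
rewrite coefsM big_ord_recr /= subnn Hg mulrC mulVKr // size_mkseq.
under [X in _ - X]eq_bigr do rewrite nth_mkseq //.
by rewrite subrKC.
Qed.

Section IntegralDomain.
Variable R : idomainType.

Let ps_idomain (f g : {powser R}) : f * g = 0 -> (f == 0) || (g == 0).
Proof.
move=> fg; apply/norP => -[/powser_factor[v [f' [ff f0]]]].
move=> /powser_factor[w [g' [gg g0]]].
have : [coef (v + w)] (f * g) = 0 by rewrite fg coefs0.
rewrite ff gg mulrACA -exprD coefsXnM ltnn subnn coefsM big_ord1 => /eqP.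
by rewrite mulf_eq0 (negPf f0) (negPf g0).
Qed.

HB.instance Definition _ :=
  GRing.ComUnitRing_isIntegral.Build {powser R} ps_idomain.

End IntegralDomain.

(* For a != 0, the fraction 1/(a - u) is the inverse of a - u in the ring of
   power series in u, i.e. the series sum_k u^k / a^(k+1). *)
Lemma powser_geom (K : fieldType) (a : K) : a != 0 ->
  (psC a - psX K \is a GRing.unit) /\
  (psC a - psX K)^-1 = \powser_(k) (a ^- k.+1).
Proof.
move=> a0; pose g : {powser K} := \powser_(k) (a ^- k.+1).
have ug : psC a - psX K \is a GRing.unit.
  by apply: powser_unit; rewrite coefsD coefsN subr0 unitfE.
split=> //; apply: (mulrI ug); rewrite divrr // -/g; apply: powserP => n.
rewrite mulrBl coefsD coefsN coefsCM coefsXM coefs1; case: n => [|n] /=.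
  by rewrite subr0 expr1 divff.
by rewrite exprS invfM mulVKf // subrr.
Qed.

(** * Square roots *)

(* The square root of f with constant term 1; it exists (uniquely) whenever f
   has constant term 1, see [ps_sqrtP]. *)
Definition ps_sqrt (f : {powser rat}) : {powser rat} :=
  xget 0 [set g : {powser rat} | g ^+ 2 = f /\ [coef 0] g = 1]%classic.

Lemma ps_sqrtP (f : {powser rat}) : [coef 0] f = 1 ->
  ps_sqrt f ^+ 2 = f /\ [coef 0] (ps_sqrt f) = 1.
Proof.
move=> f0; rewrite /ps_sqrt; case: xgetP => [g _ //|].
have [g Hg] := powser_rec (fun s => if size s is 0 then 1 else
  ([coef (size s)] f - \sum_(1 <= i < size s) s`_i * s`_(size s - i)) / 2).
have g0 : [coef 0] g = 1 by rewrite Hg.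
move=> /(_ g) []; split=> //; apply: powserP => -[|n].
  by rewrite expr2 coefsM big_ord1 g0 f0 mul1r.
have gn : [coef n.+1] g = ([coef n.+1] f -
    \sum_(i < n) [coef i.+1] g * [coef (n - i)] g) / 2.
  rewrite [LHS]Hg size_mkseq big_add1 big_mkord; congr ((_ - _) / _).
  apply: eq_bigr => i _; rewrite subSS !nth_mkseq // ?ltnS //.
  exact: leq_subr.
rewrite expr2 coefsM big_ord_recr big_ord_recl /= subnn subn0 g0 mul1r mulr1.
under eq_bigr => i _ do rewrite /bump leq0n add1n subSS.
by rewrite gn; field.
Qed.

Lemma ps_sqrt_unique (f g : {powser rat}) :
  g ^+ 2 = f -> [coef 0] g = 1 -> ps_sqrt f = g.
Proof.
move=> gf g0; have f0 : [coef 0] f = 1.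
  by rewrite -gf expr2 coefsM big_ord1 g0 mul1r.
have [qf q0] := ps_sqrtP f0.
have /eqP : ps_sqrt f ^+ 2 = g ^+ 2 by rewrite qf.
rewrite eqf_sqr => /orP[/eqP //|/eqP qg].
by have := q0; rewrite qg coefsN g0.
Qed.

(** * Laurent series *)

(* Q((z)), as the field of fractions of Q[[z]]; see [laurentP]. *)
Notation laurent := {fraction {powser rat}}.

Definition z : laurent := (psX rat)%:F.

Lemma laurentP (x : laurent) : exists (f : {powser rat}) (v : nat),
  x = f%:F / z ^+ v.
Proof.
have [a [b [b0 ->]]] : exists a b : {powser rat}, b != 0 /\ x = a%:F / b%:F.
  set y := repr x; exists (\n_y), (\d_y); split; first exact: denom_ratioP.
  apply: (canRL (mulfK _)); first by rewrite tofrac_eq0 denom_ratioP.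
  rewrite -[x]reprK -/y -[_ * _]/(FracField.mul _ _) !piE.
  apply/eqmodP; rewrite /= FracField.equivfE /FracField.mulf.
  by rewrite !numden_Ratio ?mulr1 ?oner_eq0 ?denom_ratioP // mulrC.
have [v [g [-> g0]]] := powser_factor b0.
have ug : g \is a GRing.unit by rewrite powser_unit // unitfE.
exists (a * g^-1), v.
have Fg : (g^-1)%:F = (g%:F)^-1 :> laurent by rewrite rmorphV.
by rewrite [in RHS]tofracM Fg tofracM tofracXn invfM mulrA mulrAC.
Qed.

Definition discr : {powser rat} :=
  psX rat ^+ 4 - 4 * psX rat ^+ 3 + 2 * psX rat ^+ 2 - 4 * psX rat + 1.

Definition r : laurent := (1 - z ^+ 2 + (ps_sqrt discr)%:F) / (2 * z).
Definition s : laurent := (1 - z ^+ 2 - (ps_sqrt discr)%:F) / (2 * z).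

Lemma r_neq0 : r != 0.
Proof.
have z0 : z != 0.
  rewrite tofrac_eq0; apply/eqP => /(congr1 (fun f => [coef 1] f))/eqP.
  by rewrite coefs0 oner_eq0.
have two0 : 2 != 0 :> laurent.
  rewrite -[2](rmorph_nat (@tofrac {powser rat})) tofrac_eq0; apply/eqP.
  by move=> /(congr1 (fun f => [coef 0] f))/eqP; rewrite coefsD coefs0.
rewrite /r mulf_eq0 invr_eq0 mulf_eq0 (negPf two0) (negPf z0) !orbF.
rewrite -tofrac1 -tofracXn -tofracB -tofracD tofrac_eq0; apply/eqP.
have /ps_sqrtP[_ q0] : [coef 0] discr = 1.
  by rewrite /discr !(coefsD, coefsN, coefsM, big_ord1, exprS) /=.
move=> /(congr1 (fun f => [coef 0] f))/eqP.
by rewrite !coefsD coefsN q0 coefs0 expr2 coefsM big_ord1.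
Qed.

(** * Paths *)

(* Steps and points are vectors in Z^2; a path starting at the origin is given
   by the sequence of its steps. *)
Notation vec := (int * int)%type.

Definition stepU : vec := (1, 1).
Definition stepH : vec := (1, 0).
Definition stepD (k : nat) : vec := (1, - k%:Z).

Definition is_down (x : vec) : Prop := exists2 k : nat, (1 <= k)%N & x = stepD k.

Definition endpoint (p : seq vec) : vec := \sum_(x <- p) x.

Definition height (x : vec) : int := x.2.

Local Open Scope classical_set_scope.

Definition M1 : set (seq vec) := [set p : seq vec |
  [/\ (forall x, x \in p -> [\/ x = stepU, x = stepH | is_down x]),
      (forall m, (m <= size p)%N ->
         0 <= (endpoint (take m p)).1 /\ 0 <= (endpoint (take m p)).2)
    & (forall m, (m.+1 < size p)%N ->
         ~ (is_down (nth 0 p m) /\ is_down (nth 0 p m.+1)))]].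

Definition paths (n : nat) (k : int) : set (seq vec) :=
  [set p : seq vec | [/\ M1 p, size p = n & height (endpoint p) = k]].

(* [fset_set] is the finite set equal to [paths n k], by [paths_finite]. *)
Definition t (n : nat) (k : int) : nat := #|` fset_set (paths n k)|.


Lemma endpoint_take p m : (m < size p)%N ->
  endpoint (take m.+1 p) = endpoint (take m p) + nth 0 p m.
Proof.
by move=> mp; rewrite (take_nth 0 mp) /endpoint -cats1 big_cat big_seq1.
Qed.

Lemma M1_height_le p m : M1 p -> (m <= size p)%N ->
  height (endpoint (take m p)) <= m%:Z.
Proof.
case=> steps _ _; elim: m => [|m IH] mp; first by rewrite take0 /endpoint big_nil.
rewrite endpoint_take // /height /=.
have := IH (ltnW mp); rewrite /height => hm.
have [->|->|[j _ ->]] := steps _ (mem_nth 0 mp); rewrite /=; lia.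
Qed.

Lemma paths_finite n k : finite_set (paths n k).
Proof.
pose S := stepU :: stepH :: [seq stepD j | j <- iota 0 n.+1].
pose words := fix words m :=
  if m is m'.+1 then [seq x :: w | x <- S, w <- words m'] else [:: [::]].
have wordsP w : all (mem S) w -> w \in words (size w).
  elim: w => //= x w IH /andP[xS wS].
  exact: (allpairs_f cons xS (IH wS)).
apply: (sub_finite_set _ (finite_seq (words n))) => p [Mp pn _] /=.
rewrite -pn; apply: wordsP; apply/allP => x xp; suff: x \in S by [].
have [steps pos _] := Mp.
have ip : (index x p < size p)%N by rewrite index_mem.
have [->|->|[j _ xD]] := steps _ xp; first exact: mem_head.
  by rewrite /S in_cons mem_head orbT.
have [_] := pos _ ip; rewrite endpoint_take // nth_index // xD /= => h0.
have h1 := M1_height_le Mp (ltnW ip); rewrite /height xD in h1 ip.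
have jS : stepD j \in [seq stepD j | j <- iota 0 n.+1].
  apply: map_f; rewrite mem_iota add0n /= ltnS -pn.
  have h2 := le_trans (etrans (esym (subr_ge0 _ _)) h0) h1.
  exact: leq_trans h2 (ltnW ip).
by rewrite /S; do 2!rewrite in_cons; rewrite jS !orbT.
Qed.

Lemma t_neg n k : k < 0 -> t n k = 0%N.
Proof.
move=> k0; rewrite /t (_ : paths n k = set0) ?fset_set0 ?cardfs0 //.
apply/seteqP; split=> // p [[_ pos _] _ pk].
by have [_] := pos _ (leqnn _); rewrite take_size -/(height _) pk leNgt k0.
Qed.

Definition t0 (n : nat) : int := t n 0.

(** * The generating function, in Q((z))[[u]] *)

(* [r_neq0] and [powser_geom] give 1/(r - u) its meaning. *)
Definition u : {powser laurent} := psX laurent.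

Definition Total : {powser laurent} :=
  \powser_(k) (\powser_(n) (t n k%:Z)%:R : {powser rat})%:F.

(* Main.v *)
Require Import Defs.
From mathcomp Require Import all_boot all_order all_algebra.
From mathcomp Require Import finmap ring zify.
From mathcomp Require Import boolp classical_sets cardinality.
Import Order.TTheory GRing.Theory Num.Theory.
Local Open Scope ring_scope.

(** Split the paths of length [n] and final height [k] according to whether the
    last step is a down step. Removing a last step [U] or [H] expresses the
    paths of the first kind through [t] ([t_up_rec]). For the second kind,
    shortening the last down step by one unit is a bijection onto the paths of
    that kind ending one unit higher, except for a last step [D_1], which is
    removed ([t_down_rec]). Eliminating the two auxiliary counts gives the
    linear recurrence [t_rec].

    Let [T k] be the generating function, in [z], of the paths of final height
    [k], and read [T (-1)] as [1/z]. The recurrence and its initial conditions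
    say that [r * s * T (k + 1) = (r + s) * T k - T (k - 1)] for [k >= 0], since
    [r] and [s] have sum [(1 - z ^+ 2) / z] and product [1/z - 1 + z]. Hence
    [r * T k - T (k - 1)] is [s] times its successor. Now [s] is a power series
    in [z], and [T k] is divisible by [z ^+ k] because a path of length [n] ends
    at height at most [n]. So [r * T k - T (k - 1)] is divisible by arbitrarily
    large powers of [z]: it vanishes ([zr_T]), and [T k] is geometric with ratio
    [1/r] and first term [1/(z * r)], where [1/z = 1 + r * s - z]. This is the
    formula for [Total], read in [u].

    In particular [T 0 = 1/(z * r)] inherits a quadratic equation from [r], and
    the coefficients of that equation are the convolution recurrence
    ([t0_rec]). *)

Set Implicit Arguments.
Unset Strict Implicit.

(** * Appending a step to a path *)

Definition is_step (x : vec) : Prop := [\/ x = stepU, x = stepH | is_down x].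
(** The default value [0] of [last] is not a down step, so the empty path counts
    as not ending with one. *)
Definition ends_down (p : seq vec) : Prop := is_down (last 0 p).

Lemma endpoint_rcons p x : endpoint (rcons p x) = endpoint p + x.
Proof. by rewrite /endpoint -cats1 big_cat big_seq1. Qed.

Lemma is_down_height x : is_down x -> x.2 < 0.
Proof. by case=> k k1 -> /=; lia. Qed.

Lemma is_step_fst x : is_step x -> x.1 = 1.
Proof. by case=> [->|->|[k _ ->]]. Qed.

(** Membership in [M1] quantifies over all prefixes; this one-step form is what
    makes every count below a count by last step. Abscissae impose nothing,
    because every step advances by one. *)
Lemma M1_rcons p x : M1 (rcons p x) <->
  [/\ M1 p, is_step x, 0 <= (endpoint p).2 + x.2
    & ~ (ends_down p /\ is_down x)].
Proof.
split.
  case=> steps pos sep; split.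
  - split.
    + by move=> y yp; apply: steps; rewrite mem_rcons in_cons yp orbT.
    + move=> m mp; have := pos m; rewrite size_rcons -cats1 takel_cat //.
      by apply; apply: leqW.
    + move=> m mp; have := sep m; rewrite size_rcons !nth_rcons mp (ltnW mp).
      by apply; apply: leqW.
  - by apply: steps; rewrite mem_rcons mem_head.
  - by have [_] := pos _ (leqnn _); rewrite take_size endpoint_rcons.
  - case/lastP: p steps pos sep => [|p y] _ _ sep.
      by case=> /is_down_height.
    have := sep (size p); rewrite !size_rcons !nth_rcons size_rcons.
    by rewrite ltnn eqxx ltnS leqnn ltnn eqxx /ends_down last_rcons; apply.
case=> -[steps pos sep] sx hx nd; split.
- by move=> y; rewrite mem_rcons in_cons => /orP[/eqP ->|/steps].
- move=> m; rewrite size_rcons leq_eqVlt => /orP[/eqP ->|mp].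
    rewrite -[X in take X](size_rcons p x) take_size endpoint_rcons.
    split=> //=; rewrite (is_step_fst sx).
    by have [+ _] := pos _ (leqnn _); rewrite take_size => h; apply: addr_ge0.
  by rewrite -cats1 takel_cat //; apply: pos.
- move=> m; rewrite size_rcons ltnS leq_eqVlt => /orP[/eqP mp|mp].
    rewrite !nth_rcons -mp ltnSn ltnn eqxx => -[dm dx]; apply: nd; split=> //.
    by rewrite /ends_down -nth_last -mp.
  by rewrite !nth_rcons mp (ltnW mp); apply: sep.
Qed.

Local Open Scope classical_set_scope.

Lemma paths_rcons n k p x : paths n.+1 k (rcons p x) <->
  [/\ paths n (k - x.2) p, is_step x, 0 <= k & ~ (ends_down p /\ is_down x)].
Proof.
split=> [[/M1_rcons[Mp sx hx nd]]|[[Mp pn pk] sx k0 nd]].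
  rewrite size_rcons endpoint_rcons /height /=.
  by case=> pn <-; split=> //; split=> //; rewrite /height /= addrK.
rewrite /height in pk; split; rewrite ?size_rcons ?pn //.
  by apply/M1_rcons; split=> //; rewrite pk subrK.
by rewrite endpoint_rcons /height /= pk subrK.
Qed.

(** * Counting by the last step *)

Definition upaths n k := [set p | paths n k p /\ ~ ends_down p].
Definition dpaths n k := [set p | paths n k p /\ ends_down p].
Definition t_up n k : nat := #|` fset_set (upaths n k)|.
Definition t_down n k : nat := #|` fset_set (dpaths n k)|.

Lemma upaths_finite n k : finite_set (upaths n k).
Proof. by apply: sub_finite_set (paths_finite n k) => p []. Qed.

Lemma dpaths_finite n k : finite_set (dpaths n k).
Proof. by apply: sub_finite_set (paths_finite n k) => p []. Qed.

(** Injectivity of [g] is asked on [Y] alone: [lengthen], used below,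
    identifies the empty path with the one made of the null step. *)
Lemma card_fset_set_split (T : choiceType) (X Y Z : set T) (f g : T -> T) :
  finite_set X -> finite_set Y -> injective f -> {in Y &, injective g} ->
  (forall x y, X x -> Y y -> f x <> g y) ->
  Z = (f @` X) `|` (g @` Y) ->
  #|` fset_set Z| = (#|` fset_set X| + #|` fset_set Y|)%N.
Proof.
move=> fX fY fI gI fg ->.
rewrite fset_setU; [|exact: finite_image..].
rewrite !fset_set_image // cardfsU.
rewrite card_imfset // card_in_imfset /=; last first.
  by move=> x y /=; rewrite !in_fset_set // => *; apply: gI.
rewrite [X in (_ - #|` X|)%N](_ : _ = fset0) ?cardfs0 ?subn0 //.
apply/fsetP => w; rewrite in_fset0; apply/negP; rewrite in_fsetI => /andP[].
case/imfsetP=> x /=; rewrite in_fset_set // => /set_mem Xx ->.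
by case/imfsetP=> y /=; rewrite in_fset_set // => /set_mem Yy /fg; apply.
Qed.

Lemma t_split n k : t n k = (t_up n k + t_down n k)%N.
Proof.
apply: (@card_fset_set_split _ _ _ _ id id) => //.
- exact: upaths_finite.
- exact: dpaths_finite.
- by move=> x y [_ nx] [_ dy] xy; apply: nx; rewrite xy.
- rewrite !image_id; apply/seteqP; split=> p; last by case=> -[].
  by have [] := pselect (ends_down p); [right|left].
Qed.

(** Nothing restricts what precedes a step [U] or [H], and at heights [k >= 0]
    the constraint of staying above the axis is automatic. *)
Lemma t_up_rec n (k : int) : 0 <= k -> t_up n.+1 k = (t n (k - 1) + t n k)%N.
Proof.
move=> k0.
apply: (@card_fset_set_split _ _ _ _ (rcons^~ stepU) (rcons^~ stepH)).
- exact: paths_finite.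
- exact: paths_finite.
- exact: rcons_injl.
- by move=> x y _ _; apply: rcons_injl.
- by move=> x y _ _ /rcons_inj[].
apply/seteqP; split=> [|p].
  case/lastP=> [[[]]//|p x].
  rewrite /upaths /ends_down /= last_rcons => -[/paths_rcons[pp sx _ _] nd].
  case: sx => // xE; rewrite xE in pp *; [left|right]; exists p => //.
  by rewrite subr0 in pp.
case=> -[q qp <-];
  (split; last by rewrite /ends_down last_rcons => /is_down_height).
  apply/paths_rcons; split=> //; first exact: Or31.
  by case=> _ /is_down_height.
apply/paths_rcons; split=> //; first by rewrite subr0.
  exact: Or32.
by case=> _ /is_down_height.
Qed.

(** [D_j] becomes [D_(j+1)] at the end of the path. *)
Definition lengthen (p : seq vec) : seq vec :=
  rcons (take (size p).-1 p) (last 0 p + (0, -1)).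

Lemma lengthen_rcons p x : lengthen (rcons p x) = rcons p (x + (0, -1)).
Proof.
rewrite /lengthen size_rcons last_rcons; congr rcons.
by rewrite -cats1 take_size_cat.
Qed.

Lemma stepDS j : stepD j + (0, -1) = stepD j.+1.
Proof. by congr pair => /=; lia. Qed.

(** A final [D_1] is preceded by a path not ending with a down step; a final
    [D_(j+1)] with [j >= 1] can be shortened to [D_j], which ends one unit
    higher. Comparing the heights [k] and [k + 1] thus replaces the infinite
    choice of a last down step by a two-term relation. *)
Lemma t_down_rec n (k : int) : 0 <= k ->
  t_down n.+1 k = (t_up n (k + 1) + t_down n.+1 (k + 1))%N.
Proof.
move=> k0; apply: (@card_fset_set_split _ _ _ _ (rcons^~ (stepD 1)) lengthen).
- exact: upaths_finite.
- exact: dpaths_finite.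
- exact: rcons_injl.
- move=> p q /set_mem[[_ pn _] _] /set_mem[[_ qn _] _].
  case/lastP: p pn => // p x _; case/lastP: q qn => // q y _.
  rewrite !lengthen_rcons => /rcons_inj/eqP.
  by rewrite xpair_eqE => /andP[/eqP -> /eqP/addIr ->].
- move=> p q _ [[_ qn _]]; case/lastP: q qn => // q x _.
  rewrite /ends_down last_rcons => -[j j1 ->].
  by rewrite lengthen_rcons stepDS => /rcons_inj[_ []]; lia.
apply/seteqP; split=> [|p].
  case/lastP=> [[[]]//|p x].
  rewrite /dpaths /ends_down /= last_rcons => -[/paths_rcons[pp sx _ nd] dx].
  have npd : ~ ends_down p by move=> dp; apply: nd.
  case: dx pp => -[//|[|j]] _ -> pp.
    by left; exists p => //; split.
  right; exists (rcons p (stepD j.+1)); last by rewrite lengthen_rcons stepDS.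
  have dj : is_down (stepD j.+1) by exists j.+1.
  split; last by rewrite /ends_down last_rcons.
  apply/paths_rcons; split; [|exact: Or33|lia|by case].
  by rewrite (_ : k + 1 - _ = k - (stepD j.+2).2) //=; lia.
case=> [[q [qp nq] <-]|[q + <-]].
  have d1 : is_down (stepD 1) by exists 1%N.
  split; last by rewrite /ends_down last_rcons.
  by apply/paths_rcons; split; [|exact: Or33| |case].
case/lastP: q => [[[]]//|q x].
rewrite /dpaths /ends_down /= last_rcons => -[/paths_rcons[qp _ _ nd] dx].
have nqd : ~ ends_down q by move=> dq; apply: nd.
case: dx qp => j j1 -> qp; rewrite lengthen_rcons stepDS.
have dj : is_down (stepD j.+1) by exists j.+1.
split; last by rewrite last_rcons.
apply/paths_rcons; split; [|exact: Or33|by []|by case].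
by rewrite (_ : k - _ = k + 1 - (stepD j).2) //=; lia.
Qed.

Lemma t_length0 (k : int) : t 0 k = (k == 0).
Proof.
rewrite /t; case: eqP => [->|k0].
  rewrite (_ : paths 0 0 = [set [::]]) ?fset_set1 ?cardfs1 //.
  apply/seteqP; split=> p; first by case=> _ /size0nil ->.
  move=> ->; split=> //; last by rewrite /endpoint big_nil.
  by split=> // m; rewrite leqn0 => /eqP ->; rewrite /endpoint big_nil.
rewrite (_ : paths 0 k = set0) ?fset_set0 ?cardfs0 //.
apply/seteqP; split=> // p [_ /size0nil -> pk]; apply: k0.
by rewrite -pk /endpoint big_nil.
Qed.

Lemma t_gt n k : (n < k)%N -> t n k%:Z = 0%N.
Proof.
move=> nk; rewrite /t (_ : paths n k%:Z = set0) ?fset_set0 ?cardfs0 //.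
apply/seteqP; split=> // p [Mp pn pk].
by have := M1_height_le Mp (leqnn _); rewrite take_size pk pn; lia.
Qed.

(** [t_up_rec] at heights [k] and [k - 1] together with [t_down_rec].
    Expanding [t_up n k] as well gives the recurrence of order two in [n];
    keeping it also covers [n = 0], where [t_up_rec] does not apply. *)
Lemma t_rec_up n (k : int) : 1 <= k ->
  (t n.+1 k)%:Z = (t n.+1 (k - 1))%:Z - (t n (k - 2))%:Z + (t n k)%:Z
    - (t_up n k)%:Z.
Proof.
move=> k1; rewrite (t_split n.+1 k) (t_split n.+1 (k - 1)).
rewrite !t_up_rec; [|lia..]; rewrite (@t_down_rec _ (k - 1)); last lia.
rewrite subrK (_ : k - 1 - 1 = k - 2); last lia.
move: (t n k) (t n (k - 1)) (t n (k - 2)) (t_up n k) (t_down n.+1 k).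
by move=> x y w v q; lia.
Qed.

Lemma t_rec n (k : int) : (2 <= n)%N -> 1 <= k ->
  (t n k)%:Z = (t n (k - 1))%:Z + (t (n - 1) k)%:Z
    - (t (n - 1) (k - 2))%:Z - (t (n - 2) k)%:Z - (t (n - 2) (k - 1))%:Z.
Proof.
case: n => [|[|n]] // _ k1; rewrite subn1 subn2 /=.
rewrite t_rec_up // t_up_rec; last lia.
move: (t n.+1 k) (t n.+2 (k - 1)) (t n.+1 (k - 2)) (t n k) (t n (k - 1)).
by move=> x y w v q; lia.
Qed.

Lemma t_length1 (k : int) : 1 <= k ->
  (t 1 k)%:Z = (t 1 (k - 1))%:Z - (t 0 (k - 2))%:Z.
Proof.
move=> k1; have := t_split 0 k.
rewrite t_rec_up // t_length0 (_ : k == 0 = false); last lia.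
by case: (t_up 0 k) => // _; rewrite addr0 subr0.
Qed.

Local Close Scope classical_set_scope.

(** * The generating functions of fixed final height *)

Notation X := (psX rat).

Definition T (k : nat) : {powser rat} := \powser_(n) (t n k%:Z)%:R.
(** [X * T (k - 1)], extended to [k = 0] as if [T (-1)] were [1/z]. With this
    convention [T_kernel_rec] holds from [k = 0] on, initial conditions
    included. *)
Definition XTpred (k : nat) : {powser rat} := if k is j.+1 then X * T j else 1.

Lemma coefs_XTpred k n : [coef n] (XTpred k) =
  if n is m.+1 then (t m (k%:Z - 1))%:R else (k == 0%N)%:R.
Proof.
case: k => [|k]; last first.
  by rewrite /XTpred coefsXM; case: n => // n; rewrite /= -addn1 PoszD addrK.
by rewrite coefs1; case: n => // n; rewrite t_neg.
Qed.

Lemma T_kernel_rec k :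
  (1 - X + X ^+ 2) * T k.+1 = (1 - X ^+ 2) * T k - XTpred k.
Proof.
apply: powserP => n.
rewrite !mulrDl !mulNr !mul1r !(coefsD, coefsN).
rewrite !coefsXnM !coefsXM coefs_XTpred /=.
case: n => [|[|n]] /=.
- rewrite !t_length0; case: k => [|k] /=; ring.
- rewrite [t 0 k.+1]t_gt //; have := @t_length1 k.+1 isT.
  rewrite (_ : k.+1%:Z - 1 = k) 1?(_ : k.+1%:Z - 2 = k%:Z - 1); [|lia..].
  move=> /(congr1 (intr : int -> rat)); rewrite rmorphB /= -!pmulrn => E.
  by rewrite [in LHS]E; ring.
have := @t_rec n.+2 k.+1 isT isT; rewrite subn1 subn2 /=.
rewrite (_ : k.+1%:Z - 1 = k) 1?(_ : k.+1%:Z - 2 = k%:Z - 1); [|lia..].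
move=> /(congr1 (intr : int -> rat)); rewrite !(rmorphB, rmorphD) /=.
rewrite -!pmulrn => E.
by rewrite [in LHS]E; ring.
Qed.

(** * The kernel method *)

Lemma coefs0_discr : [coef 0] discr = 1.
Proof. by rewrite /discr !(coefsD, coefsN, coefsM, big_ord1, exprS) /=. Qed.

Lemma unit2 : (2 : {powser rat}) \is a GRing.unit.
Proof. by apply: powser_unit; rewrite coefsD unitfE. Qed.

(** Unlike [r] itself, [z * r] is a power series; see [zrE]. *)
Definition zr : {powser rat} := (1 - X ^+ 2 + ps_sqrt discr) / 2.

Lemma double_zr : 2 * zr = 1 - X ^+ 2 + ps_sqrt discr.
Proof. by rewrite mulrC divrK // unit2. Qed.

Lemma zr_quadratic : zr ^+ 2 - (1 - X ^+ 2) * zr + X * (1 - X + X ^+ 2) = 0.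
Proof.
have [sq _] := ps_sqrtP coefs0_discr.
apply: (mulrI unit2); apply: (mulrI unit2); rewrite !mulr0.
rewrite [LHS](_ : _ = (2 * zr) ^+ 2 - 2 * (1 - X ^+ 2) * (2 * zr)
  + 4 * (X * (1 - X + X ^+ 2))); last by ring.
rewrite double_zr [LHS](_ : _ = ps_sqrt discr ^+ 2 - (1 - X ^+ 2) ^+ 2
  + 4 * (X * (1 - X + X ^+ 2))); last by ring.
by rewrite sq /discr; ring.
Qed.

Lemma unit_zr : zr \is a GRing.unit.
Proof.
have [_ q0] := ps_sqrtP coefs0_discr.
have c2 : [coef 0] (2 * zr) = 2.
  by rewrite double_zr !coefsD coefsN q0 expr2 coefsM big_ord1 mul0r subr0.
apply: powser_unit; rewrite unitfE; apply/eqP => zr0.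
by move: c2; rewrite coefsM big_ord1 zr0 mulr0.
Qed.

(** Vieta's formula [z * (r + s) = 1 - z ^+ 2], with [s] replaced by
    [(z * (r * s)) / (z * r)], a power series as [z * r] is invertible. *)
Lemma zr_kernel : zr + X * ((1 - X + X ^+ 2) / zr) = 1 - X ^+ 2.
Proof.
apply: (mulIr unit_zr); rewrite mulrDl -(mulrA X) divrK ?unit_zr //.
by apply/subr0_eq; rewrite -[RHS]zr_quadratic; ring.
Qed.

(** The kernel method without substitution of [s] for [u]: the two roots of
    the kernel turn the second-order recurrence into [W j = s * W j.+1] for the
    defect [W] of the claim. As a path of length [n] cannot end above height
    [n], the valuation of [W j] is at least [j], while
    [W k = s ^+ i * W (k + i)] for all [i]; hence [W k = 0]. *)
Lemma zr_T k : zr * T k = XTpred k.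
Proof.
pose W j := zr * T j - XTpred j; pose S := (1 - X + X ^+ 2) / zr.
have WS j : W j = S * W j.+1.
  (* Here [S * zr] is [1 - X + X ^+ 2] and [zr + X * S] is [1 - X ^+ 2]. *)
  rewrite /W mulrBr mulrA divrK ?unit_zr // T_kernel_rec -zr_kernel -/S /=.
  ring.
have WSn i j : W j = S ^+ i * W (j + i)%N.
  elim: i => [|i IH]; first by rewrite mul1r addn0.
  by rewrite IH WS exprSr addnS mulrA.
have W0 j n : (n < j)%N -> [coef n] (W j) = 0.
  move=> nj; rewrite coefsD coefsN coefsM big1 => [|i _].
    rewrite coefs_XTpred; case: n j nj => [|n] [|j] // nj.
    by rewrite (_ : j.+1%:Z - 1 = j) ?t_gt ?subr0 //; lia.
  by rewrite /= t_gt ?mulr0 // (leq_ltn_trans (leq_subr _ _)).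
apply/eqP; rewrite -subr_eq0; apply/eqP/powserP => n.
rewrite -/(W k) (WSn n.+1) coefsM coefs0 big1 // => i _.
by rewrite W0 ?mulr0 // ltn_addl // ltnS leq_subr.
Qed.

(** [T 0] is the inverse of [zr], so this is [zr_quadratic] divided by
    [zr ^+ 2]. *)
Lemma T0_quadratic : T 0 = 1 + X ^+ 2 * T 0 + (X - X ^+ 2 + X ^+ 3) * T 0 ^+ 2.
Proof.
have h := zr_T 0; rewrite /= in h.
have := congr1 (fun f => f * T 0 ^+ 2) zr_quadratic; rewrite mul0r.
rewrite [LHS](_ : _ = (zr * T 0) ^+ 2 - (1 - X ^+ 2) * (zr * T 0) * T 0
  + X * (1 - X + X ^+ 2) * T 0 ^+ 2); last by ring.
rewrite h expr1n mulr1 => E.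
by apply/subr0_eq; rewrite -[RHS]oppr0 -[in RHS]E; ring.
Qed.

(** * Laurent series *)

Lemma z_neq0 : z != 0.
Proof.
rewrite tofrac_eq0; apply/eqP => /(congr1 (fun f => [coef 1] f))/eqP.
by rewrite coefs0 oner_eq0.
Qed.

Lemma two_neq0 : 2 != 0 :> laurent.
Proof.
rewrite -[2](rmorph_nat (@tofrac {powser rat})) tofrac_eq0.
by apply: contraTneq unit2 => ->; rewrite unitr0.
Qed.

Lemma zrE : zr%:F = z * r.
Proof.
apply: (mulfI two_neq0); rewrite /r.
rewrite -[2 in LHS](rmorph_nat (@tofrac {powser rat})) -tofracM double_zr.
rewrite !(tofracD, tofracN, tofracXn) -/z.
by rewrite mulrA mulrC divfK // mulf_neq0 ?two_neq0 ?z_neq0.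
Qed.

(** With [x = z] and [q] the root of the discriminant, this is
    [z * (r * s) = 1 - z + z ^+ 2]. Stated over an abstract field so
    that [field] does not unfold the operations of Laurent series. *)
Lemma roots_product (F : fieldType) (x q : F) : x != 0 -> 2 != 0 :> F ->
  q ^+ 2 = x ^+ 4 - 4 * x ^+ 3 + 2 * x ^+ 2 - 4 * x + 1 ->
  1 + (1 - x ^+ 2 + q) / (2 * x) * ((1 - x ^+ 2 - q) / (2 * x)) - x = x^-1.
Proof.
move=> x0 two0 qq.
rewrite [LHS](_ : _ = 1 - x + ((1 - x ^+ 2) ^+ 2 - q ^+ 2) / (2 * x) ^+ 2).
  by rewrite qq; field; rewrite x0 two0.
by field; rewrite x0 two0.
Qed.

Lemma rsE : 1 + r * s - z = z^-1.
Proof.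
have [sq _] := ps_sqrtP coefs0_discr.
have := congr1 (@tofrac _) sq; rewrite tofracXn /discr.
rewrite !(tofracD, tofracN, tofracM, tofracXn, rmorph_nat) -/z => E.
exact: roots_product z_neq0 two_neq0 E.
Qed.

Lemma eq_div_of_mulf (F : fieldType) (x y a b : F) :
  x != 0 -> y != 0 -> x * y * a = x * b -> a = b / y.
Proof.
move=> x0 y0; rewrite -mulrA => /(mulfI x0) <-.
by rewrite mulrC mulKf.
Qed.

Lemma coefs_Total k : [coef k] Total = (1 + r * s - z) / r ^+ k.+1.
Proof.
rewrite rsE -[LHS]/((T k)%:F); elim: k => [|k IH].
  rewrite expr1; apply: (eq_div_of_mulf z_neq0 r_neq0).
  by rewrite -zrE -tofracM zr_T tofrac1 mulfV ?z_neq0.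
rewrite exprSr invfM mulrA -IH.
by apply: (eq_div_of_mulf z_neq0 r_neq0); rewrite -zrE -!tofracM zr_T.
Qed.

Lemma Total_eq : Total = psC (1 + r * s - z) / (psC r - u).
Proof.
have [_ ->] := powser_geom r_neq0.
by apply: powserP => k; rewrite coefs_Total coefsCM.
Qed.

(** * The convolution recurrence for paths ending on the axis *)

(** [T0_quadratic] read coefficientwise. The terms [(X - X ^+ 2) * T 0 ^+ 2]
    give the convolution with [t0 k - t0 (k - 1)]; its terms [k = 0] and
    [k = 1] are [t0 (n - 1)] and [0], since [t0 0 = t0 1 = 1]. *)
Lemma t0_rec n : (2 <= n)%N ->
  t0 n = t0 (n - 1) + t0 (n - 2)
    + \sum_(0 <= k < n - 2) t0 k * t0 (n - k - 3)
    + \sum_(2 <= k < n) (t0 k - t0 (k - 1)) * t0 (n - k - 1).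
Proof.
case: n => [|[|n]] // _; rewrite subn1 subn2 /=.
apply: (@intr_inj rat).
have cT m : [coef m] (T 0) = (t0 m)%:~R by [].
have t00 : t0 0 = 1 by rewrite /t0 t_length0.
have t01 : t0 1 = 1.
  (* At [k = 1] this gives [t 1 0 = t 1 1], at [k = 2] [t 1 1 = t 0 0]. *)
  have := @t_length1 1 isT; rewrite subrr (@t_neg 0 (1 - 2)) // subr0 /t0 => <-.
  have := @t_length1 2 isT.
  by rewrite (@t_gt 1 2) // t_length0 => /esym/subr0_eq.
pose C m : int := \sum_(i < m.+1) t0 i * t0 (m - i).
have CT m : [coef m] (T 0 ^+ 2) = (C m)%:~R.
  by rewrite expr2 coefsM /C rmorph_sum; apply: eq_bigr => i _; rewrite rmorphM.
have E1 : \sum_(0 <= k < n) t0 k * t0 (n.+2 - k - 3)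
    = if n is m.+1 then C m else 0.
  case: n => [|n]; first by rewrite big_geq.
  by rewrite big_mkord; apply: eq_bigr => i _; congr (_ * t0 _); lia.
have E2 : \sum_(2 <= k < n.+2) (t0 k - t0 (k - 1)) * t0 (n.+2 - k - 1)
    = C n.+1 - C n - t0 n.+1.
  rewrite 2!big_add1 big_mkord /C !big_ord_recl t00 t01 !mul1r /=.
  rewrite !subn0 subn1 /=.
  rewrite [RHS](_ : _ = \sum_(i < n) t0 i.+2 * t0 (n.+1 - i.+2)
    - \sum_(i < n) t0 i.+1 * t0 (n - i.+1)); last by rewrite /bump /=; ring.
  rewrite -sumrB; apply: eq_bigr => i _; rewrite mulrBl.
  by congr (_ * t0 _ - t0 _ * t0 _); lia.
have := congr1 (fun f => [coef n.+2] f) T0_quadratic.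
rewrite E1 E2 !mulrDl mulNr !(coefsD, coefsN) coefsXM !coefsXnM.
rewrite !CT cT coefs1 /=.
rewrite subn2 add0r -[(t n 0)%:R]/((t0 n)%:~R) => ->.
rewrite !(rmorphD, rmorphB, rmorphN) /=.
by case: n {E1 E2} => [|n] /=; rewrite ?subSS ?subn0; ring.
Qed.

Theorem theorem1 :
  [/\ Total = psC (1 + r * s - z) / (psC r - u),
      (forall k : nat, [coef k] Total = (1 + r * s - z) / r ^+ k.+1),
      (forall (n : nat) (k : int), (2 <= n)%N -> 1 <= k ->
         (t n k)%:Z = (t n (k - 1))%:Z + (t (n - 1) k)%:Z
           - (t (n - 1) (k - 2))%:Z - (t (n - 2) k)%:Z
           - (t (n - 2) (k - 1))%:Z)
    & (forall n : nat, (2 <= n)%N ->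
         t0 n = t0 (n - 1) + t0 (n - 2)
           + \sum_(0 <= k < n - 2) t0 k * t0 (n - k - 3)
           + \sum_(2 <= k < n) (t0 k - t0 (k - 1)) * t0 (n - k - 1))].
Proof.
split; [exact: Total_eq|exact: coefs_Total|exact: t_rec|exact: t0_rec].
Qed.
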